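(* Let $n \ge 1$ and let $X, X_1, \ldots, X_n$ be independent, identically distributed real-valued random variables with $\mathbf{P}(X \ge 0) = 1$. Let $X_{(1)} \le \cdots \le X_{(n)}$ be the order statistics of $X_1, \ldots, X_n$, and set $X_{(0)} = 0$. Let $U_{(1)} \le \cdots \le U_{(n)}$ be the order statistics of $n$ independent random variables uniformly distributed on $[0,1]$. For any vector $u = (u_1, \ldots, u_n) \in [0,1]^n$ define $$p_u = \mathbf{P}\big(U_{(1)} \le u_1, \ldots, U_{(n)} \le u_n\big),$$ set $u_{n+1} = 1$, and define $$B_u = \sum_{k=1}^n (1-u_k)\big(X_{(k)} - X_{(k-1)}\big).$$ Then, for every $u \in [0,1]^n$, $$B_u = \sum_{k=1}^n (u_{k+1} - u_k) X_{(k)},$$ and $B_u$ is a level-$p_u$ lower confidence bound for the expectation $\mathbf{E}X$, that is, $$\mathbf{P}\big(B_u > \mathbf{E}X\big) \le 1 - p_u .$$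
   Context: The order statistics of a finite list of real random variables are the same values arranged in non-decreasing order. A random variable $B = B(X_1,\ldots,X_n)$ is a lower confidence bound (LCB) for $\mathbf{E}X$ of (confidence) level $1-\alpha$ if $\mathbf{P}(B > \mathbf{E}X) \le \alpha$. The distribution of $X$ is otherwise arbitrary (it need not be continuous). Since $X \ge 0$ almost surely, $\mathbf{E}X$ is well defined in $[0,\infty]$. *)

(* Defs.v *)
From mathcomp Require Import all_boot all_order all_algebra.
From mathcomp Require Import all_classical all_reals all_analysis.

Set Implicit Arguments.
Unset Strict Implicit.
Unset Printing Implicit Defensive.

Import Order.TTheory GRing.Theory Num.Theory.

Local Open Scope classical_set_scope.
Local Open Scope ring_scope.

(* The product rule over the whole finite index set: a subfamily is handled by
   taking [A i = setT] outside of it. *)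
Definition mutually_independent (R : realType) (d : measure_display)
    (T : measurableType d) (P : probability T R) (I : finType)
    (X : I -> {RV P >-> R}) : Prop :=
  forall A : I -> set R, (forall i, measurable (A i)) ->
    P [set w | forall i, A i (X i w)]
    = (\prod_(i : I) P [set w | A i (X i w)])%E.

Definition identically_distributed (R : realType) (d : measure_display)
    (T : measurableType d) (P : probability T R) (I : finType)
    (X : I -> {RV P >-> R}) : Prop :=
  forall (i j : I) (A : set R), measurable A ->
    distribution P (X i) A = distribution P (X j) A.

Definition iid (R : realType) (d : measure_display)
    (T : measurableType d) (P : probability T R) (I : finType)
    (X : I -> {RV P >-> R}) : Prop :=
  mutually_independent X /\ identically_distributed X.

Definition iid_uniform01 (R : realType) (d : measure_display)
    (T : measurableType d) (P : probability T R) (I : finType)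
    (U : I -> {RV P >-> R}) : Prop :=
  mutually_independent U /\
  forall (i : I) (A : set R), measurable A ->
    distribution P (U i) A = uniform_prob (@ltr01 R) A.

Definition sample (R : realType) (d : measure_display)
    (T : measurableType d) (P : probability T R) (n : nat)
    (X : 'I_n -> {RV P >-> R}) (w : T) : n.-tuple R :=
  [tuple X i w | i < n].

(* [order_stat x k] is x_(k) for 1 <= k <= size x, and x_(0) = 0. *)
Definition order_stat (R : realType) (x : seq R) (k : nat) : R :=
  nth 0 (0 :: sort <=%R x) k.

(* In the sums below k : 'I_n is zero-based: [tnth u k] is u_{k+1}. *)
Definition p_ (R : realType) (d : measure_display)
    (T : measurableType d) (P : probability T R) (n : nat)
    (U : 'I_n -> {RV P >-> R}) (u : n.-tuple R) : \bar R :=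
  P [set w | forall k : 'I_n, order_stat (sample U w) k.+1 <= tnth u k].

Definition B_ (R : realType) (n : nat) (u x : n.-tuple R) : R :=
  \sum_(k < n) (1 - tnth u k) * (order_stat x k.+1 - order_stat x k).

(* The statistic [b] of the sample is a lower confidence bound of level [p]
   (= 1 - alpha) for E Y.  The expectation is extended-real valued, so that
   E Y = +oo is allowed. *)
Definition lower_confidence_bound (R : realType) (d : measure_display)
    (T : measurableType d) (P : probability T R) (n : nat)
    (Y : {RV P >-> R}) (X : 'I_n -> {RV P >-> R})
    (b : n.-tuple R -> R) (p : \bar R) : Prop :=
  measurable_fun [set: n.-tuple R] b /\
  (P [set w | 'E_P[Y] < (b (sample X w))%:E] <= 1 - p)%E.

(* Main.v *)
Require Import Defs.
From mathcomp Require Import all_boot all_order all_algebra.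
From mathcomp Require Import all_classical all_reals all_analysis measurable_realfun.
From mathcomp Require Import ring lra.

Set Implicit Arguments.
Unset Strict Implicit.
Unset Printing Implicit Defensive.

Import Order.TTheory GRing.Theory Num.Theory.

Local Open Scope classical_set_scope.
Local Open Scope ring_scope.

(** Write [F-(y) = P (X < y)].  If the sample [x] is nonnegative and
    [F-(x_(k)) <= u_k] for every [k], then [1 - u_k <= P (X >= x_(k))], hence
    B_u is at most [\sum_k P (X >= x_(k)) * (x_(k) - x_(k-1))].  This is the
    expectation of [\sum_k 1_{X >= x_(k)} * (x_(k) - x_(k-1))], a telescoping sum
    equal to the largest [x_(k)] not exceeding [X], so at most [X]
    ([expectation_ge_indic_sum]).  The bound can therefore exceed E X only if some
    [F-(X_(k)) > u_k], and it remains to show that the event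
    [G = { F-(X_(k)) <= u_k for all k }] has probability at least [p_u]
    ([p_le_order_stat_event]).

    Let [A_k = { y | F-(y) <= u_k }], a down-set of the line, and [a_k = P (X \in A_k)].
    Then [a_k >= u_k] ([strict_cdf_le_ge]): [F-(X)] is stochastically smaller than
    a uniform variable, whether or not X has atoms.  The event [X_(k) \in A_k] says
    that at least [k] of the sample points lie in [A_k] ([order_stat_downset]), so G
    depends on each [X_i] only through the set of those [k] with [X_i \in A_k].  The
    [A_k] form a chain, so the law of this finite random set is determined by the
    numbers [a_k]; the half-lines [`]-oo, a_k]] form a chain with the same
    probabilities under the uniform law ([chain_mem_pattern_eq_measure]).  By
    independence G has the same probability as [{ U_(k) <= a_k for all k }]
    ([independent_mem_pattern_eq_measure]), which contains
    [{ U_(k) <= u_k for all k }].  Comparing the laws of finite membership patterns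
    replaces the construction of a quantile coupling of X with U and the
    uniqueness of product measures. *)

(** * Membership patterns of a finite family of sets *)

Section mem_pattern.
Context d (T : measurableType d) (R : realType) (P : probability T R).

Lemma measurable_forall_fin (K : finType) (A : K -> set T) :
  (forall k, measurable (A k)) -> measurable [set w | forall k, A k w].
Proof.
move=> mA.
have -> : [set w | forall k, A k w] = \bigcap_(k in [set: K]) A k.
  by apply/seteqP; split => w /= Aw k => [_|]; exact: Aw.
by apply: fin_bigcap_measurable => *; [exact: finite_finset|].
Qed.

Lemma measurable_finpred (C : finType) (f : T -> C) (E : pred C) :
  (forall c, measurable [set w | f w = c]) -> measurable [set w | E (f w)].
Proof.
move=> mf.
have -> : [set w | E (f w)] = \bigcup_(c in [set` E]) [set w | f w = c].
  by apply/seteqP; split => w /= => [Efw|[c Ec ->]]; first exists (f w).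
by apply: fin_bigcup_measurable => [|c _]; [exact: finite_finpred|exact: mf].
Qed.

Lemma measure_finpred (C : finType) (f : T -> C) (E : pred C) :
  (forall c, measurable [set w | f w = c]) ->
  P [set w | E (f w)] = (\sum_(c \in [set` E]) P [set w | f w = c])%E.
Proof.
move=> mf.
have -> : [set w | E (f w)] = \bigcup_(c in [set` E]) [set w | f w = c].
  by apply/seteqP; split => w /= => [Efw|[c Ec ->]]; first exists (f w).
rewrite measure_fin_bigcup//.
by move=> c c' _ _ [w [/= <- <-]].
Qed.

Definition mem_pattern (K : finType) (S : Type) (A : K -> set S) (x : S) : {set K} :=
  [set k | `[< A k x >]].

Lemma measurable_mem_pattern (K : finType) (A : K -> set T) (c : {set K}) :
  (forall k, measurable (A k)) -> measurable [set w | mem_pattern A w = c].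
Proof.
move=> mA.
have -> : [set w | mem_pattern A w = c] =
    [set w | forall k, (if k \in c then A k else ~` A k) w].
  apply/seteqP; split => w /=.
    by move=> <- k; rewrite inE; case: asboolP.
  move=> Aw; apply/setP => k; rewrite inE; have := Aw k.
  by case: ifPn => _ ?; [apply/asboolP|apply/asboolPn].
apply: measurable_forall_fin => k; case: ifP => _ //; exact: measurableC.
Qed.

End mem_pattern.

(** * Patterns of chains *)

Section chain_law.
Context d (T : measurableType d) d' (T' : measurableType d') (R : realType).
Variables (P : probability T R) (Q : probability T' R) (K : finType).

(** A nonempty intersection of members of a chain is its smallest member.  The
    inclusions are required to follow the values of a common [u] so that the
    same index is smallest in both chains. *)
Lemma chain_cap_eq_measure (A : K -> set T) (B : K -> set T') (u : K -> R)
    (c : {set K}) :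
  (forall k l, u k <= u l -> A k `<=` A l) ->
  (forall k l, u k <= u l -> B k `<=` B l) ->
  (forall k, P (A k) = Q (B k)) ->
  P [set w | forall k, k \in c -> A k w] = Q [set w | forall k, k \in c -> B k w].
Proof.
move=> chA chB AB.
have [c0|[k0 k0c]] := set_0Vmem c.
  have -> : [set w | forall k, k \in c -> A k w] = setT.
    by apply/seteqP; split => w //= _ k; rewrite c0 inE.
  have -> : [set w | forall k, k \in c -> B k w] = setT.
    by apply/seteqP; split => w //= _ k; rewrite c0 inE.
  by rewrite !probability_setT.
have [m mc mmin] := arg_minP u k0c.
have -> : [set w | forall k, k \in c -> A k w] = A m.
  by apply/seteqP; split => w /= => [/(_ m mc)//|Am k /mmin/chA]; exact.
have -> : [set w | forall k, k \in c -> B k w] = B m.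
  by apply/seteqP; split => w /= => [/(_ m mc)//|Bm k /mmin/chB]; exact.
exact: AB.
Qed.

(** The pattern is [c] on the intersection of two events: V, where all [A k] with
    [k] in [c] occur, and W, where no other [A k] occurs.  If some [A k] with [k] in [c]
    lies below some [A l] with [l] outside [c], the pattern is impossible.
    Otherwise the complement of W, a union of smaller members of the chain, is
    contained in V, so that the probability is [P V - (1 - P W)]; here V is an
    intersection of members of the chain, and W of the chain of complements. *)
Lemma chain_mem_pattern_eq_measure (A : K -> set T) (B : K -> set T') (u : K -> R)
    (c : {set K}) :
  (forall k, measurable (A k)) -> (forall k, measurable (B k)) ->
  (forall k l, u k <= u l -> A k `<=` A l) ->
  (forall k l, u k <= u l -> B k `<=` B l) ->
  (forall k, P (A k) = Q (B k)) ->
  P [set w | mem_pattern A w = c] = Q [set w | mem_pattern B w = c].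
Proof.
move=> mA mB chA chB AB.
have mem_patternE S (D : K -> set S) : [set w | mem_pattern D w = c] =
    [set w | forall k, k \in c -> D k w] `&`
    [set w | forall k, k \in ~: c -> ~ D k w].
  apply/seteqP; split => w /=.
    by move=> <-; split => k; rewrite !inE // => /asboolPn.
  move=> [Dc DNc]; apply/setP => k; rewrite inE.
  have [kc|kNc] := boolP (k \in c); first exact/asboolP/Dc.
  by apply/asboolPn/DNc; rewrite inE.
have [[k [l [kc lc ukl]]]|sep] :=
    pselect (exists k l, [/\ k \in c, l \notin c & u k <= u l]).
  have -> : [set w | mem_pattern A w = c] = set0.
    rewrite mem_patternE -subset0 => w /= [/(_ k kc) Ak /(_ l)]; rewrite inE lc.
    by move=> /(_ isT)[]; exact: (chA _ _ ukl).
  have -> : [set w | mem_pattern B w = c] = set0.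
    rewrite mem_patternE -subset0 => w /= [/(_ k kc) Bk /(_ l)]; rewrite inE lc.
    by move=> /(_ isT)[]; exact: (chB _ _ ukl).
  by rewrite !measure0.
have sepu k l : k \in c -> l \notin c -> u l <= u k.
  by move=> kc lc; rewrite leNgt; apply/negP => /ltW ukl; apply: sep; exists k, l.
have cover S (D : K -> set S) : (forall k l, u k <= u l -> D k `<=` D l) ->
    ~` [set w | forall k, k \in ~: c -> ~ D k w] `<=`
    [set w | forall k, k \in c -> D k w].
  move=> chD w /= /existsNP[l /not_implyP[lc /contrapT Dl]] k kc.
  by apply: (chD l k) => //; apply: sepu => //; rewrite inE in lc.
have mcap e (S : measurableType e) (D : K -> set S) (c' : {set K}) :
    (forall k, measurable (D k)) ->
    measurable [set w | forall k, k \in c' -> D k w].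
  move=> mD; have -> : [set w | forall k, k \in c' -> D k w] =
      \bigcap_(k in [set` c']) D k by [].
  by apply: fin_bigcap_measurable => *; [apply: finite_finpred|].
have capE e (S : measurableType e) (M : probability S R) (D : K -> set S) :
    (forall k, measurable (D k)) ->
    (forall k l, u k <= u l -> D k `<=` D l) ->
    (M [set w | mem_pattern D w = c] =
     M [set w | forall k, k \in c -> D k w] -
     (1 - M [set w | forall k, k \in ~: c -> ~ D k w]))%E.
  move=> mD chD; rewrite mem_patternE -[X in _ `&` X]setCK -setDE.
  have mNcap := mcap _ _ (fun k => ~` D k) (~: c) (fun k => measurableC (mD k)).
  rewrite measureD.
  - rewrite (setIidr (cover _ _ chD)); congr (_ - _)%E.
    exact: probability_setC.
  - exact: mcap.
  - exact: measurableC.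
  - by rewrite ltey_eq fin_num_measure//; exact: mcap.
rewrite !capE// (chain_cap_eq_measure c chA chB AB).
congr (_ - (_ - _))%E.
(* Complements reverse inclusions, hence the order [- u]. *)
apply: (@chain_cap_eq_measure (fun k => ~` A k) (fun k => ~` B k) (fun k => - u k)).
- by move=> k l; rewrite lerN2 => /chA/subsetC.
- by move=> k l; rewrite lerN2 => /chB/subsetC.
- by move=> k; rewrite !probability_setC// AB.
Qed.

End chain_law.

(** * Joint patterns of independent variables *)

Lemma measurable_joint_mem_pattern (R : realType) d (T : measurableType d)
    (P : probability T R) (I K : finType) (X : I -> {RV P >-> R})
    (A : K -> set R) (c : {ffun I -> {set K}}) :
  (forall k, measurable (A k)) ->
  measurable [set w | [ffun i => mem_pattern A (X i w)] = c].
Proof.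
move=> mA; have -> : [set w | [ffun i => mem_pattern A (X i w)] = c] =
    [set w | forall i, [set w | mem_pattern (fun k => X i @^-1` A k) w = c i] w].
  apply/seteqP; split => w /=; first by move=> <- i; rewrite ffunE.
  by move=> Xc; apply/ffunP => i; rewrite ffunE; exact: Xc.
apply: measurable_forall_fin => i; apply: measurable_mem_pattern => k.
exact: measurable_funPTI.
Qed.

Lemma mutually_independent_Some (R : realType) d (T : measurableType d)
    (P : probability T R) (I : finType) (X : option I -> {RV P >-> R}) :
  mutually_independent X -> mutually_independent (X \o Some).
Proof.
move=> indX A mA; pose A' i := if i is Some k then A k else setT.
have mA' i : measurable (A' i) by case: i => //=.
have -> : [set w | forall i, A i ((X \o Some) i w)] =
    [set w | forall i, A' i (X i w)].
  by apply/seteqP; split => w /= Xw => [[i|]//|i]; exact: (Xw (Some i)).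
rewrite (indX A' mA') (bigD1 None)//= (reindex_omap Some id)/=; last by case.
rewrite (_ : [set _ | True] = setT); last by apply/seteqP.
rewrite probability_setT mul1e; apply: eq_bigl => i.
by rewrite eqxx.
Qed.

Lemma independent_mem_pattern_law (R : realType) d (T : measurableType d)
    (P : probability T R) (I K : finType) (X : I -> {RV P >-> R}) (A : K -> set R)
    (c : {ffun I -> {set K}}) :
  mutually_independent X -> (forall k, measurable (A k)) ->
  P [set w | [ffun i => mem_pattern A (X i w)] = c] =
    (\prod_i P [set w | mem_pattern (fun k => X i @^-1` A k) w = c i])%E.
Proof.
move=> indX mA.
rewrite -(indX (fun i => [set x | mem_pattern A x = c i]))/=; last first.
  by move=> i; exact: measurable_mem_pattern.
congr (P _); apply/seteqP; split => w /=.
  by move=> <- i; rewrite ffunE.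
by move=> Xc; apply/ffunP => i; rewrite ffunE.
Qed.

(** An event expressed through the joint pattern is a finite disjoint union of
    rectangles, so independence reduces its probability to the laws of the
    individual patterns. *)
Lemma independent_mem_pattern_eq_measure (R : realType)
    d (T : measurableType d) d' (T' : measurableType d')
    (P : probability T R) (Q : probability T' R) (I K : finType)
    (X : I -> {RV P >-> R})
    (Y : I -> {RV Q >-> R}) (A B : K -> set R) (u : K -> R)
    (E : pred {ffun I -> {set K}}) :
  mutually_independent X -> mutually_independent Y ->
  (forall k, measurable (A k)) -> (forall k, measurable (B k)) ->
  (forall k l, u k <= u l -> A k `<=` A l) ->
  (forall k l, u k <= u l -> B k `<=` B l) ->
  (forall i k, P (X i @^-1` A k) = Q (Y i @^-1` B k)) ->
  P [set w | E [ffun i => mem_pattern A (X i w)]] =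
  Q [set w | E [ffun i => mem_pattern B (Y i w)]].
Proof.
move=> indX indY mA mB chA chB AB.
rewrite (measure_finpred P (f := fun w => [ffun i => mem_pattern A (X i w)]))//; last first.
  by move=> c; exact: measurable_joint_mem_pattern.
rewrite (measure_finpred Q (f := fun w => [ffun i => mem_pattern B (Y i w)]))//; last first.
  by move=> c; exact: measurable_joint_mem_pattern.
apply: eq_fsbigr => c _.
rewrite (independent_mem_pattern_law _ indX)// (independent_mem_pattern_law _ indY)//.
apply: eq_bigr => i _.
apply: (chain_mem_pattern_eq_measure (u := u)).
- by move=> k; exact: measurable_funPTI.
- by move=> k; exact: measurable_funPTI.
- by move=> k l /chA; exact: preimage_subset.
- by move=> k l /chB; exact: preimage_subset.
- exact: AB.
Qed.

(** * Order statistics *)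

(** In a sorted sequence the elements of a down-set form a prefix, whose length is
    their number. *)
Lemma nth_sorted_downset (R : realDomainType) (D : pred R) (s : seq R) (k : nat) :
  (forall x y, x <= y -> D y -> D x) -> sorted <=%R s -> (k < size s)%N ->
  D (nth 0 s k) = (k < count D s)%N.
Proof.
move=> downD; elim: s k => //= x s IHs k xs ks.
have sorteds : sorted <=%R s by exact: path_sorted xs.
(* If the head is outside [D], so is the whole sequence. *)
have headD : (0 < count D s)%N -> D x.
  rewrite -has_count => /hasP[y ys Dy]; apply: downD Dy.
  by move: xs; rewrite (path_sortedE le_trans) => /andP[/allP /(_ y ys)].
case: k ks => [_|k ks] /=.
  by case: (boolP (D x)) => //= /negP Dx; apply/esym/negP => /headD.
rewrite IHs//; case: (boolP (D x)) => //= /negP Dx.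
have -> : count D s = 0%N by case: count headD => // m /(_ isT).
by [].
Qed.

Lemma order_stat_downset (R : realType) (n : nat) (D : pred R) (x : n.-tuple R)
    (k : 'I_n) :
  (forall y z, y <= z -> D z -> D y) ->
  D (order_stat x k.+1) = (k < #|[set i | D (tnth x i)]%SET|)%N.
Proof.
move=> downD; rewrite /order_stat /= (nth_sorted_downset downD).
- congr (_ < _)%N; rewrite -[in LHS](map_tnth_enum x) count_sort count_map.
  by rewrite cardE [in RHS]/enum_mem size_filter -enumT; apply: eq_count => i /=; rewrite inE.
- by apply: sort_sorted; exact: le_total.
- by rewrite size_sort size_tuple.
Qed.

Lemma order_stat_nondecreasing (R : realType) (n : nat) (x : n.-tuple R) :
  (forall i, 0 <= tnth x i) ->
  forall k, (k < n)%N -> order_stat x k <= order_stat x k.+1.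
Proof.
move=> x0 [|k] kn; rewrite /order_stat /=.
  have : nth 0 (sort <=%R x) 0 \in x.
    by rewrite -(mem_sort <=%R) mem_nth// size_sort size_tuple.
  by move=> /tnthP[i ->].
apply: (sorted_leq_nth le_trans le_refl) => //.
- by apply: sort_sorted; exact: le_total.
- by rewrite inE size_sort size_tuple ltnW.
- by rewrite inE size_sort size_tuple.
Qed.

(** [x_(k) < r] is a condition on the number of coordinates below [r], hence on the
    pattern of the half-spaces [x_i < r]. *)
Lemma measurable_order_stat (R : realType) (n : nat) (k : nat) : (k <= n)%N ->
  measurable_fun [set: n.-tuple R] (fun x : n.-tuple R => order_stat x k).
Proof.
case: k => [_|k kn]; first exact: measurable_cst.
apply: (measurability (@RGenInftyO.G R)) => [|/= _ [_] [r] -> <-].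
  exact: RGenInftyO.measurableE.
rewrite setTI.
pose below (x : n.-tuple R) := [set i | tnth x i < r]%SET.
have -> : (fun x : n.-tuple R => order_stat x k.+1) @^-1` `]-oo, r[ =
    [set x | [pred S : {set 'I_n} | k < #|S|]%N (below x)].
  apply/seteqP; split => x /=; rewrite in_itv/=;
    by rewrite (@order_stat_downset R n (fun y => y < r) x (Ordinal kn))// => y z; exact: le_lt_trans.
apply: measurable_finpred => S.
have -> : [set x | below x = S] =
    [set x | mem_pattern (fun i : 'I_n => [set x : n.-tuple R | tnth x i < r]) x = S].
  by apply/seteqP; split => x /= <-; apply/setP => i; rewrite !inE ?asboolb.
apply: measurable_mem_pattern => i.
rewrite -[X in measurable X]setTI.
have := @measurable_tnth _ R n i measurableT `]-oo, r[%classic (measurable_itv _).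
by congr measurable; apply/seteqP; split => x [_ /=]; rewrite in_itv.
Qed.

(** * The bound and the expectation *)

(** Since [s] is nondecreasing, the terms kept are an initial segment and telescope
    to the largest [s k] not exceeding [y]. *)
Lemma telescope_indic_le (R : realDomainType) (s : nat -> R) (n : nat) (y : R) :
  s 0 = 0 -> 0 <= y -> (forall k, (k < n)%N -> s k <= s k.+1) ->
  \sum_(k < n) (s k.+1 - s k) * (s k.+1 <= y)%R%:R <= y.
Proof.
move=> s0 y0 nds.
(* The bound by [s n] is what the induction needs when [s n.+1 <= y]. *)
suff /andP[] : (\sum_(k < n) (s k.+1 - s k) * (s k.+1 <= y)%R%:R <= s n) &&
    (\sum_(k < n) (s k.+1 - s k) * (s k.+1 <= y)%R%:R <= y) by [].
elim: n nds => [|n IHn] nds; first by rewrite big_ord0 s0 lexx y0.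
have /andP[IHs IHy] := IHn (fun k kn => nds k (ltnW kn)).
have sn := nds n (ltnSn n).
rewrite big_ord_recr /=; case: (leP (s n.+1) y) => sy; rewrite ?mulr1 ?mulr0; lra.
Qed.

Lemma sum_by_parts (R : comRingType) (v s : nat -> R) (n : nat) :
  s 0 = 0 -> v n = 1 ->
  \sum_(k < n) (1 - v k) * (s k.+1 - s k) =
  \sum_(k < n) (v k.+1 - v k) * s k.+1.
Proof.
move=> s0 vn.
(* Abel summation up to an arbitrary [m] leaves the boundary term [(1 - v m) * s m]. *)
suff -> m : \sum_(k < m) (1 - v k) * (s k.+1 - s k) =
    \sum_(k < m) (v k.+1 - v k) * s k.+1 + (1 - v m) * s m.
  by rewrite vn subrr mul0r addr0.
elim: m => [|m IHm]; first by rewrite !big_ord0 s0 mulr0 addr0.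
by rewrite !big_ord_recr/= IHm; ring.
Qed.

Lemma measurable_B_ (R : realType) (n : nat) (u : n.-tuple R) :
  measurable_fun [set: n.-tuple R] (B_ u).
Proof.
apply: measurable_sum => k.
apply: measurable_funM; first exact: measurable_cst.
by apply: measurable_funB; apply: measurable_order_stat; rewrite ?ltn_ord// ltnW.
Qed.

(** [\sum_k 1_{X >= s k.+1} * (s k.+1 - s k)] is almost surely at most X by
    [telescope_indic_le], and its expectation bounds the left-hand side because
    [1 - c k <= P (X >= s k.+1)]. *)
Lemma expectation_ge_indic_sum (R : realType) d (T : measurableType d)
    (P : probability T R) (X : {RV P >-> R}) (n : nat) (s c : nat -> R) :
  P [set w | 0 <= X w] = 1%E ->
  s 0 = 0 -> (forall k, (k < n)%N -> s k <= s k.+1) ->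
  (forall k, (k < n)%N -> (P [set w | (X w < s k.+1)%R] <= (c k)%:E)%E) ->
  ((\sum_(k < n) (1 - c k) * (s k.+1 - s k))%:E <= 'E_P[X])%E.
Proof.
move=> X0 s0 nds Pc.
have mX := measurable_funPT X.
(* X is nonnegative only almost surely; the positive part has the same expectation
   and is nonnegative everywhere. *)
pose Xpos := fun w => Num.max 0 (X w).
have mXpos : measurable_fun setT Xpos by exact: measurable_maxr.
pose tail k := [set w | s k.+1 <= X w].
have mtail k : measurable (tail k).
  rewrite (_ : tail k = X @^-1` `[s k.+1, +oo[).
    exact: measurable_funPTI.
  by apply/seteqP; split => w /=; rewrite in_itv/= andbT.
pose g w := \sum_(k < n) (s k.+1 - s k) * \1_(tail k) w.
have ds0 (k : 'I_n) : 0 <= s k.+1 - s k by rewrite subr_ge0 nds.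
have mg : measurable_fun setT g.
  by apply: measurable_sum => k; apply: measurable_funM => //; exact: measurable_indic.
have g0 w : 0 <= g w by apply: sumr_ge0 => k _; rewrite mulr_ge0.
have aeX0 : {ae P, forall w, (0 <= X w)%R}.
  exists [set w | X w < 0]; split.
  - rewrite (_ : [set _ | _] = X @^-1` `]-oo, 0[); first exact: measurable_funPTI.
    by apply/seteqP; split => w /=; rewrite in_itv.
  - rewrite (_ : [set _ | _] = ~` [set w | 0 <= X w]); last first.
      by apply/seteqP; split => w /=; rewrite ltNge => /negP.
    rewrite probability_setC ?X0 ?subee//.
    rewrite (_ : [set _ | _] = X @^-1` `[0, +oo[); first exact: measurable_funPTI.
    by apply/seteqP; split => w /=; rewrite in_itv/= andbT.
  - by move=> w /= /negP; rewrite -ltNge.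
have -> : ('E_P[X] = 'E_P[Xpos])%E.
  rewrite unlock; apply: ae_eq_integral => //.
  - exact/measurable_EFinP.
  - exact/measurable_EFinP.
  - by apply: filterS aeX0 => w Xw _; rewrite /Xpos max_r.
have gXpos : ('E_P[g] <= 'E_P[Xpos])%E.
  apply: expectation_le => //; first by move=> w; rewrite le_max lexx.
  apply: filterS aeX0 => w Xw; rewrite /Xpos max_r//.
  apply: le_trans (telescope_indic_le s0 Xw nds).
  by apply: ler_sum => k _; rewrite indicE mem_setE.
apply: le_trans gXpos.
have -> : ('E_P[g] = \sum_(k < n) (s k.+1 - s k)%:E * P (tail k))%E.
  rewrite unlock.
  under eq_integral do rewrite /g -sumEFin.
  rewrite ge0_integral_sum//.
  - apply: eq_bigr => k _; under eq_integral do rewrite EFinM.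
    rewrite ge0_integralZl_EFin// ?integral_indic ?setIT//.
    by apply/measurable_EFinP; exact: measurable_indic.
  - by move=> k; apply/measurable_EFinP; apply: measurable_funM => //; exact: measurable_indic.
  - by move=> k w _; rewrite lee_fin mulr_ge0.
rewrite -sumEFin; apply: lee_sum => k _.
rewrite mulrC EFinM; apply: lee_wpmul2l; first by rewrite lee_fin.
rewrite -[tail k]setCK probability_setC; last exact: measurableC.
rewrite EFinB; apply: leeB => //.
rewrite (_ : ~` _ = [set w | X w < s k.+1]); first exact: Pc.
by apply/seteqP; split => w /=; rewrite ltNge => /negP.
Qed.

(** * Uniform law and strict distribution function *)

Lemma uniform_prob_Nyc (R : realType) (a : R) : 0 <= a <= 1 ->
  uniform_prob (@ltr01 R) `]-oo, a] = a%:E.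
Proof.
move=> /andP[a0 a1]; rewrite /uniform_prob integral_uniform_pdf.
have -> : `]-oo, a] `&` `[0, 1] = `[0, a]%classic :> set R.
  apply/seteqP; split => x /=; rewrite !in_itv/=; lra.
rewrite (eq_integral (cst 1%E)); last first.
  move=> x; rewrite inE/= in_itv/= => /andP[x0 xa].
  by rewrite /uniform_pdf x0 (le_trans xa a1) subr0 invr1.
rewrite integral_cst// mul1e/= lebesgue_measure_itv/= lte_fin.
by case: ltgtP a0 => // [_ _|<-]; rewrite ?oppr0 ?adde0.
Qed.

Section strict_cdf.
Context (R : realType) d (T : measurableType d) (P : probability T R).
Variable X : {RV P >-> R}.

(** The strict inequality [X w < x] makes this set large enough for
    [strict_cdf_le_ge] when X has atoms, and it matches the tails [X >= s k.+1] in
    [expectation_ge_indic_sum]. *)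
Definition strict_cdf_le (v : R) : set R :=
  [set x | (P [set w | (X w < x)%R] <= v%:E)%E].

Let mlt (x : R) : measurable [set w | X w < x].
Proof.
rewrite (_ : [set _ | _] = X @^-1` `]-oo, x[); first exact: measurable_funPTI.
by apply/seteqP; split => w /=; rewrite in_itv.
Qed.

Lemma strict_cdf_le_downset (v x y : R) : x <= y -> strict_cdf_le v y -> strict_cdf_le v x.
Proof.
move=> xy; apply: le_trans; apply: le_measure; rewrite ?inE//.
by move=> w /= /lt_le_trans; exact.
Qed.

Lemma measurable_strict_cdf_le (v : R) : measurable (strict_cdf_le v).
Proof.
apply: is_interval_measurable => x y Ax Ay z /andP[_ zy].
exact: strict_cdf_le_downset Ay.
Qed.

(** [F-(X)] is stochastically dominated by a uniform variable.  Let [A] be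
    the set of points with [F- <= v].  When it is neither empty nor the whole line,
    it is a half-line; let [s] be its supremum.  If [s] belongs to [A], then [P (X \in A) = F(s)], a right limit of values [F(x) >= F-(x) > v].
    Otherwise [P (X \in A) = F-(s) > v], as [s] is outside [A]. *)
Lemma strict_cdf_le_ge (v : R) : 0 <= v <= 1 ->
  (v%:E <= P (X @^-1` strict_cdf_le v))%E.
Proof.
move=> /andP[v0 v1]; set A := strict_cdf_le v.
have mXA : measurable (X @^-1` A).
  by apply: measurable_funPTI; exact: measurable_strict_cdf_le.
have cdf_ge x : ~ A x -> (v%:E <= cdf X x)%E.
  move=> /negP; rewrite -ltNge => /ltW/le_trans; apply.
  apply: le_measure; rewrite ?inE//; first exact: measurable_funPTI.
  by move=> w /=; rewrite in_itv/= => /ltW.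
have [AT|/existsNP[b Ab]] := pselect (forall x, A x).
  rewrite (_ : _ @^-1` _ = setT) ?probability_setT ?lee_fin//.
  by apply/seteqP; split => // w _; exact: AT.
(* If [A] is empty, then F exceeds [v] everywhere, and F tends to 0 at -oo. *)
have [[a Aa]|/forallNP A0] := pselect (exists a, A a); last first.
  rewrite (@le_trans _ _ 0%E)//.
  have := @cvg_cdfNy0 _ _ _ P X.
  by apply: cvge_ge; apply: nearW => x; exact: cdf_ge.
have ltb x : A x -> x < b.
  move=> Ax; rewrite ltNge; apply/negP => bx; apply: Ab.
  exact: strict_cdf_le_downset Ax.
have supA : has_sup A by split; [exists a|exists b => x /ltb/ltW].
have geS x : sup A < x -> ~ A x.
  by move=> sx /(ub_le_sup supA.2); rewrite leNgt sx.
have ltS x : x < sup A -> A x.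
  move=> xs; have [y Ay xy] := sup_gt supA.1 xs.
  exact: strict_cdf_le_downset (ltW xy) Ay.
have [As|As] := pselect (A (sup A)).
  have : (v%:E <= cdf X (sup A))%E.
    apply: (cvge_ge _ (@cdf_right_continuous _ _ _ P X (sup A))).
    near=> x; apply: cdf_ge; apply: geS; near: x; exact: nbhs_right_gt.
  move=> /le_trans; apply; apply: le_measure; rewrite ?inE//; first exact: measurable_strict_cdf_le.
  move=> x /=; rewrite in_itv/= => xs; exact: strict_cdf_le_downset xs As.
apply: ltW; move/negP: (As); rewrite -ltNge => /lt_le_trans; apply.
apply: le_measure; rewrite ?inE//; move=> w /=; exact: ltS.
Unshelve. all: by end_near.
Qed.

End strict_cdf.

(** * Events on order statistics as patterns *)

(** Here [c i] is the set of the indices [k] such that the [i]-th sample point lies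
    in the [k]-th down-set; with zero-based [k], the [k.+1]-th order statistic
    lies there when more than [k] sample points do. *)
Definition enough_below (n : nat) : pred {ffun 'I_n -> {set 'I_n}} :=
  fun c => [forall k : 'I_n, k < #|[set i | k \in c i]%SET|]%N.

Lemma order_stat_event (R : realType) d (T : measurableType d)
    (P : probability T R) (n : nat) (Z : 'I_n -> {RV P >-> R})
    (C : 'I_n -> set R) :
  (forall k y z, y <= z -> C k z -> C k y) ->
  [set w | forall k : 'I_n, C k (order_stat (sample Z w) k.+1)] =
  [set w | enough_below [ffun i => mem_pattern C (Z i w)]].
Proof.
move=> downC.
have eqC w (k : 'I_n) : `[< C k (order_stat (sample Z w) k.+1) >] =
    (k < #|[set i | k \in [ffun i => mem_pattern C (Z i w)] i]%SET|)%N.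
  rewrite (@order_stat_downset R n (fun y => `[< C k y >])).
    congr (_ < _)%N; apply: eq_card => i.
    by rewrite !inE ffunE inE tnth_mktuple.
  by move=> y z yz /asboolP Cz; apply/asboolP; exact: downC Cz.
apply/seteqP; split => w /= => [Cw|/forallP Cw k].
  by apply/forallP => k; rewrite -eqC; exact/asboolP.
by apply/asboolP; rewrite eqC.
Qed.

Lemma measurable_order_stat_event (R : realType) d (T : measurableType d)
    (P : probability T R) (n : nat) (Z : 'I_n -> {RV P >-> R})
    (C : 'I_n -> set R) :
  (forall k y z, y <= z -> C k z -> C k y) -> (forall k, measurable (C k)) ->
  measurable [set w | forall k : 'I_n, C k (order_stat (sample Z w) k.+1)].
Proof.
move=> downC mC; rewrite order_stat_event//.
by apply: measurable_finpred => c; exact: measurable_joint_mem_pattern.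
Qed.

(** The events [X_(k) \in A k] have jointly the probability of [U_(k) <= a k],
    where [a k = P (X \in A k)]; then [u_k <= a k] concludes. *)
Lemma p_le_order_stat_event (R : realType) d (T : measurableType d)
    (P : probability T R) d' (T' : measurableType d') (Q : probability T' R)
    (n : nat) (X : {RV P >-> R}) (Xs : 'I_n -> {RV P >-> R})
    (U : 'I_n -> {RV Q >-> R}) (u : n.-tuple R) :
  mutually_independent Xs ->
  (forall i (A : set R), measurable A -> P (Xs i @^-1` A) = P (X @^-1` A)) ->
  iid_uniform01 U -> (forall k, 0 <= tnth u k <= 1) ->
  (p_ U u <= P [set w | forall k : 'I_n,
    strict_cdf_le X (tnth u k) (order_stat (sample Xs w) k.+1)])%E.
Proof.
move=> Xs_indep X_distr [U_indep U_unif] u01.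
pose A k := strict_cdf_le X (tnth u k).
have mA k : measurable (A k) by exact: measurable_strict_cdf_le.
have downA k y z : y <= z -> A k z -> A k y by exact: strict_cdf_le_downset.
pose a k := fine (P (X @^-1` A k)).
have mXA k : measurable (X @^-1` A k) by exact: measurable_funPTI.
have PA k : P (X @^-1` A k) = (a k)%:E by rewrite fineK// fin_num_measure.
have ua k : tnth u k <= a k by rewrite -lee_fin -PA; exact: strict_cdf_le_ge.
have a01 k : 0 <= a k <= 1 by rewrite -!lee_fin -PA measure_ge0 probability_le1.
have chA k l : tnth u k <= tnth u l -> A k `<=` A l.
  by move=> ukl x /le_trans; apply; rewrite lee_fin.
have alea k l : tnth u k <= tnth u l -> a k <= a l.
  move=> /chA kl; rewrite -lee_fin -!PA; apply: le_measure; rewrite ?inE//.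
  exact: preimage_subset.
pose D (b : 'I_n -> R) k : set R := `]-oo, b k]%classic.
have DE b k y : D b k y = (y <= b k) by rewrite /D /= in_itv.
have mD b k : measurable (D b k) by exact: measurable_itv.
have downD b k y z : y <= z -> D b k z -> D b k y by rewrite !DE; exact: le_trans.
(* Replacing [A] by [D a] keeps the probabilities and the order of the chain. *)
have -> : P [set w | forall k : 'I_n, A k (order_stat (sample Xs w) k.+1)] =
    Q [set w | forall k : 'I_n, D a k (order_stat (sample U w) k.+1)].
  rewrite !order_stat_event//; last exact: downD.
  apply: (independent_mem_pattern_eq_measure (u := tnth u)) => //.
  - by move=> k l /alea akl x; rewrite !DE => /le_trans; exact.
  - move=> i k; rewrite X_distr// PA -(uniform_prob_Nyc (a01 k)).
    by rewrite -(U_unif i _ (measurable_itv _)).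
have -> : p_ U u = Q [set w | forall k : 'I_n,
    D (tnth u) k (order_stat (sample U w) k.+1)].
  by congr (Q _); apply/seteqP; split => w /= Uw k; have := Uw k; rewrite DE.
apply: le_measure; rewrite ?inE; [by apply: measurable_order_stat_event => //; exact: downD..|].
by move=> w /= Uw k; have := Uw k; rewrite !DE => /le_trans; exact.
Qed.

(** * The lower confidence bound *)

Theorem theorem1 (R : realType) (n : nat) (n_ge1 : (1 <= n)%N)
    (d : measure_display) (T : measurableType d) (P : probability T R)
    (X : {RV P >-> R}) (Xs : 'I_n -> {RV P >-> R})
    (X_iid : iid (fun i : option 'I_n => if i is Some k then Xs k else X))
    (X_ge0 : P [set w | 0 <= X w] = 1%E)
    (d' : measure_display) (T' : measurableType d') (Q : probability T' R)
    (U : 'I_n -> {RV Q >-> R}) (U_iid : iid_uniform01 U)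
    (u : n.-tuple R) (u01 : forall k : 'I_n, 0 <= tnth u k <= 1) :
  (forall w : T, B_ u (sample Xs w) =
    \sum_(k < n) (nth 1 u k.+1 - nth 1 u k) * order_stat (sample Xs w) k.+1) /\
  lower_confidence_bound X Xs (B_ u) (p_ U u).
Proof.
have u_nth (k : 'I_n) : tnth u k = nth 1 u k by exact: tnth_nth.
have BE x : B_ u x =
    \sum_(k < n) (1 - nth 1 u k) * (order_stat x k.+1 - order_stat x k).
  by apply: eq_bigr => k _; rewrite u_nth.
split=> [w|].
  by rewrite BE (@sum_by_parts _ (nth 1 u) (order_stat _))// nth_default ?size_tuple.
split; first exact: measurable_B_.
case: X_iid => X_indep X_ident.
have Xs_indep : mutually_independent Xs.
  exact: (mutually_independent_Some X_indep).
have X_distr i (A : set R) : measurable A -> P (Xs i @^-1` A) = P (X @^-1` A).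
  by move=> mA; exact: (X_ident (Some i) None).
(* On [G `&` N] the bound is at most E X, and [N] has probability 1. *)
pose G := [set w | forall k : 'I_n,
  strict_cdf_le X (tnth u k) (order_stat (sample Xs w) k.+1)].
have mG : measurable G.
  apply: (@measurable_order_stat_event _ _ _ _ _ Xs
    (fun k => strict_cdf_le X (tnth u k))).
    by move=> k y z; exact: strict_cdf_le_downset.
  by move=> k; exact: measurable_strict_cdf_le.
pose N := [set w | forall i, `[0, +oo[%classic (Xs i w)].
have mN : measurable N.
  by apply: measurable_forall_fin => i; exact: measurable_funPTI.
have PN : P N = 1%E.
  rewrite (Xs_indep (fun=> `[0, +oo[%classic))// big1// => i _.
  rewrite -[LHS]/(P (Xs i @^-1` _)) X_distr// -[RHS]X_ge0; congr (P _).
  by apply/seteqP; split => w /=; rewrite in_itv/= andbT.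
have PNC : P (~` N) = 0%E by rewrite probability_setC// PN subee.
have PGN : P (~` G `|` ~` N) = (1 - P G)%E.
  rewrite measureU0; [exact: probability_setC|exact: measurableC..|].
  exact: PNC.
apply: (@le_trans _ _ (1 - P G)%E); last first.
  by apply: leeB => //; exact: p_le_order_stat_event.
rewrite -PGN; apply: le_measure.
- rewrite inE -[X in measurable X]setTI; apply: measurable_lte => //.
  apply/measurable_EFinP; apply: (measurableT_comp (measurable_B_ u)).
  apply/measurable_fun_tnthP => i.
  rewrite (_ : _ \o _ = Xs i)//.
  by apply/funext => w /=; rewrite tnth_mktuple.
- by rewrite inE; apply: measurableU; exact: measurableC.
- move=> w /= EB; apply/not_andP => -[Gw Nw].
  move: EB; apply/negP; rewrite -leNgt BE; apply: expectation_ge_indic_sum => //.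
  + apply: order_stat_nondecreasing => i; rewrite tnth_mktuple.
    by have := Nw i; rewrite /= in_itv/= andbT.
  + by move=> k kn; have := Gw (Ordinal kn); rewrite /strict_cdf_le /= u_nth.
Qed.
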